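(* Let $m\ge 3$. For the Cartesian product $P_2\square C_m$ of the path $P_2$ of order $2$ and the cycle $C_m$ of order $m$, the harmonic centralization is zero: $C_{\mathcal H}(P_2\square C_m)=0$.
   Context: All graphs are simple, undirected and finite. For a graph $G$ of order $n\ge 2$ (number of vertices) and a vertex $u$, the harmonic centrality of $u$ is $\mathcal{H}_G(u)=\frac{\mathcal{R}_G(u)}{n-1}$, where $\mathcal{R}_G(u)=\sum_{x\in V(G),\,x\ne u}\frac{1}{d(u,x)}$, $d$ is the shortest-path distance in $G$, and $\frac{1}{d(u,x)}=0$ if there is no path from $u$ to $x$. For a graph $G$ of order $n\ge 3$, the harmonic centralization is $$C_{\mathcal H}(G)=\frac{\sum_{x\in V(G)}\big(\mathcal{H}_{G,\max}-\mathcal{H}_G(x)\big)}{\frac{n-2}{2}},\qquad \mathcal{H}_{G,\max}=\max_{x\in V(G)}\mathcal{H}_G(x).$$ The Cartesian product $G\square H$ has vertex set $V(G)\times V(H)$, with $(u,v)$ and $(u',v')$ adjacent iff either $u=u'$ and $v,v'$ are adjacent in $H$, or $v=v'$ and $u,u'$ are adjacent in $G$. *)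

(* Defs.v *)
From HB Require Import structures.
From mathcomp Require Import all_boot all_order all_algebra.

Set Implicit Arguments.
Unset Strict Implicit.
Unset Printing Implicit Defensive.

Import Order.TTheory GRing.Theory Num.Theory.

Record sgraph := SGraph {
  vertex :> finType;
  adj : rel vertex;
  adj_sym : symmetric adj;
  adj_irrefl : irreflexive adj
}.

Section Distance.

Variable G : sgraph.
Implicit Types (x y : G) (k : nat).

(* As in path.v, a path starting at x is given by the sequence of its vertices
   after x, so the size of that sequence is the length of the path. *)
Definition has_path x y k : bool :=
  [exists p : k.-tuple G,
     [&& path (@adj G) x p, uniq (x :: p) & last x p == y]].

Lemma has_path_connect x y :
  connect (@adj G) x y -> exists k, has_path x y k.
Proof.
case/connectP=> p p_path ->; case/shortenP: p_path => q q_path q_uniq _.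
exists (size q); apply/existsP; exists (in_tuple q).
by rewrite q_path q_uniq eqxx.
Qed.

Definition dist x y : option nat :=
  if boolP (connect (@adj G) x y) is AltTrue xy
  then Some (ex_minn (has_path_connect xy)) else None.

End Distance.

Local Open Scope ring_scope.

Section HarmonicCentrality.

Variable G : sgraph.

Definition inv_dist (x y : G) : rat :=
  if dist x y is Some k then k%:R^-1 else 0.

Definition harmonic_sum (u : G) : rat := \sum_(x : G | x != u) inv_dist u x.

Definition harmonic_centrality (u : G) : rat :=
  harmonic_sum u / (#|G|%:R - 1).

(* Harmonic centralities are nonnegative, so starting the iterated maximum at 0
   does not change its value on a nonempty graph. *)
Definition max_harmonic_centrality : rat :=
  \big[Num.max/0]_(x : G) harmonic_centrality x.

Definition harmonic_centralization : rat :=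
  (\sum_(x : G) (max_harmonic_centrality - harmonic_centrality x))
    / ((#|G|%:R - 2) / 2).

End HarmonicCentrality.

Local Close Scope ring_scope.

Section CartesianProduct.

Variables G H : sgraph.

Definition cart_adj : rel (G * H) := fun a b =>
  ((a.1 == b.1) && adj a.2 b.2) || ((a.2 == b.2) && adj a.1 b.1).

Lemma cart_adj_sym : symmetric cart_adj.
Proof.
by move=> a b; rewrite /cart_adj ![_ == b.1]eq_sym ![_ == b.2]eq_sym
  (adj_sym a.1) (adj_sym a.2).
Qed.

Lemma cart_adj_irrefl : irreflexive cart_adj.
Proof. by move=> a; rewrite /cart_adj !adj_irrefl !andbF. Qed.

Definition cartesian_product : sgraph := SGraph cart_adj_sym cart_adj_irrefl.

End CartesianProduct.

Definition path_adj n : rel 'I_n := fun i j => (j == i.+1 :> nat) || (i == j.+1 :> nat).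

Lemma path_adj_sym n : symmetric (@path_adj n).
Proof. by move=> i j; rewrite /path_adj orbC. Qed.

Lemma path_adj_irrefl n : irreflexive (@path_adj n).
Proof. by move=> i; rewrite /path_adj orbb ltn_eqF. Qed.

Definition path_graph n : sgraph := SGraph (@path_adj_sym n) (@path_adj_irrefl n).

(* ordS is the cyclic successor on 'I_n; the condition i != j only matters for
   n = 1, where ordS has a fixed point. *)
Definition cycle_adj n : rel 'I_n := fun i j =>
  (i != j) && ((j == ordS i) || (i == ordS j)).

Lemma cycle_adj_sym n : symmetric (@cycle_adj n).
Proof. by move=> i j; rewrite /cycle_adj eq_sym orbC. Qed.

Lemma cycle_adj_irrefl n : irreflexive (@cycle_adj n).
Proof. by move=> i; rewrite /cycle_adj eqxx. Qed.

Definition cycle_graph n : sgraph :=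
  SGraph (@cycle_adj_sym n) (@cycle_adj_irrefl n).

(* Main.v *)
(** Harmonic centrality is preserved by graph automorphisms, so the harmonic
    centralization of a vertex-transitive graph vanishes.  The prism is
    vertex-transitive: apply a transposition to the [P_2] coordinate and a
    rotation to the [C_m] coordinate. *)
Require Import Defs.
From mathcomp Require Import all_boot all_order all_algebra.
From mathcomp Require Import perm.

Set Implicit Arguments.
Unset Strict Implicit.
Unset Printing Implicit Defensive.

Import Order.TTheory GRing.Theory Num.Theory.

(** On a finite vertex set an injective self-map is bijective, with inverse [finv f]. *)
Definition automorphism (G : sgraph) (f : G -> G) : Prop :=
  injective f /\ {mono f : x y / adj x y}.

Definition vertex_transitive (G : sgraph) : Prop :=
  forall x y : G, exists2 f : G -> G, automorphism f & f x = y.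

Section Automorphism.

Variable G : sgraph.
Implicit Types (f : G -> G) (x y u v : G).

Lemma automorphism_finv f : automorphism f -> automorphism (finv f).
Proof.
move=> [f_inj f_adj]; split; first exact: finv_inj.
by move=> x y; rewrite -f_adj !f_finv.
Qed.

Lemma automorphism_has_path f x y k :
  automorphism f -> has_path (f x) (f y) k = has_path x y k.
Proof.
(* An automorphism carries a path to a path of the same length; the converse direction is this fact
   for [finv f]. *)
have sub (g : G -> G) u v :
    automorphism g -> has_path u v k -> has_path (g u) (g v) k.
  move=> [g_inj g_adj] /existsP[p /and3P[p_path p_uniq /eqP p_last]].
  apply/existsP; exists (map_tuple g p).
  rewrite (mono_path g_adj) p_path -map_cons map_inj_uniq // p_uniq.
  by rewrite last_map p_last eqxx.
move=> f_aut; apply/idP/idP; last exact: sub.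
move/(sub _ _ _ (automorphism_finv f_aut)).
by case: f_aut => f_inj _; rewrite !finv_f.
Qed.

Lemma has_path_connected x y k : has_path x y k -> connect (@adj G) x y.
Proof.
case/existsP=> p /and3P[p_path _ /eqP <-].
by apply/connectP; exists p.
Qed.

(** [dist] matches on a connectivity proof, so the hypothesis cannot be rewritten in it directly:
    both matches are split, and in the connected case each minimum bounds the other. *)
Lemma eq_dist x y u v : has_path x y =1 has_path u v -> dist x y = dist u v.
Proof.
move=> eq_xyuv; rewrite /dist.
case: {-}_ / (boolP (connect _ x y)) => [xy|nxy];
  case: {-}_ / (boolP (connect _ u v)) => [uv|nuv] //.
- congr Some; case: ex_minnP => i i_path i_min.
  case: ex_minnP => j j_path j_min.
  apply/eqP; rewrite eqn_leq i_min ?eq_xyuv //=.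
  by rewrite j_min // -eq_xyuv.
- have [k] := has_path_connect xy.
  by rewrite eq_xyuv => /has_path_connected; rewrite (negPf nuv).
- have [k] := has_path_connect uv.
  by rewrite -eq_xyuv => /has_path_connected; rewrite (negPf nxy).
Qed.

Lemma automorphism_harmonic_centrality f x :
  automorphism f -> harmonic_centrality (f x) = harmonic_centrality x.
Proof.
move=> f_aut; have [f_inj _] := f_aut.
rewrite /harmonic_centrality /harmonic_sum (reindex_inj f_inj) /=.
congr (_ / _)%R; apply: eq_big => [z|z _]; first by rewrite (inj_eq f_inj).
rewrite /inv_dist (@eq_dist (f x) (f z) x z) // => k.
exact: automorphism_has_path.
Qed.

(** Needed because the iterated maximum starts at 0. *)
Lemma harmonic_centrality_ge0 x : (0 <= harmonic_centrality x)%R.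
Proof.
apply: divr_ge0; last by rewrite subr_ge0 ler1n; apply/card_gt0P; exists x.
by apply: sumr_ge0 => z _; rewrite /inv_dist; case: dist => // k; rewrite invr_ge0 ler0n.
Qed.

Lemma vertex_transitive_harmonic_centralization :
  vertex_transitive G -> harmonic_centralization G = 0%R.
Proof.
move=> G_trans; rewrite /harmonic_centralization big1 ?mul0r // => x _.
(* Each summand vanishes: by transitivity every centrality equals that of [x], which is therefore
   the maximum. *)
apply/eqP; rewrite subr_eq0 eq_le; apply/andP; split; last exact: le_bigmax.
apply: bigmax_le => [|y _]; first exact: harmonic_centrality_ge0.
by have [f f_aut <-] := G_trans x y; rewrite automorphism_harmonic_centrality.
Qed.

End Automorphism.

Lemma vertex_transitive_cartesian_product (G H : sgraph) :
  vertex_transitive G -> vertex_transitive H ->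
  vertex_transitive (cartesian_product G H).
Proof.
move=> G_trans H_trans [x u] [y v].
have [f [f_inj f_adj] fx] := G_trans x y.
have [g [g_inj g_adj] gu] := H_trans u v.
exists (fun a => (f a.1, g a.2)); last by rewrite fx gu.
split=> [[a b] [c d] [/f_inj -> /g_inj ->] //|a b].
by rewrite /= /cart_adj /= (inj_eq f_inj) (inj_eq g_inj) f_adj g_adj.
Qed.

Lemma vertex_transitive_path_graph2 : vertex_transitive (path_graph 2).
Proof.
(* [P_2] is complete, so every permutation of its vertices is an automorphism. *)
have adjE (i j : 'I_2) : path_adj i j = (i != j).
  by case: i j => [[|[|//]] ?] [[|[|//]] ?].
move=> x y; exists (tperm x y : 'I_2 -> 'I_2); last exact: tpermL.
by split=> [|i j]; [exact: perm_inj | rewrite /= !adjE (inj_eq perm_inj)].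
Qed.

Lemma vertex_transitive_cycle_graph m : vertex_transitive (cycle_graph m).
Proof.
(* Orders 0 and 1 are split off; the remaining vertex set ['I_m.+2] is the ring of integers modulo
   [m.+2], where rotations are translations. *)
case: m => [|[|m]]; first by case.
  by move=> x y; exists id; [split | rewrite [x]ord1 [y]ord1].
move=> x y; exists (fun i : 'I_m.+2 => i + (y - x))%R; last by rewrite /= addrC subrK.
have ordSE (i : 'I_m.+2) : ordS i = (i + 1)%R.
  by apply: val_inj; rewrite /= modnDmr addn1.
split=> [|i j]; first exact: addIr.
(* The translation commutes with the successor [+ 1], hence cancels from each equality. *)
by rewrite /= /cycle_adj !ordSE ![(_ + (y - x) + 1)%R]addrAC !(inj_eq (addIr _)).
Qed.

Theorem theorem3p5 (m : nat) (hm : 3 <= m) :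
  harmonic_centralization (cartesian_product (path_graph 2) (cycle_graph m)) = 0%R.
Proof.
apply: vertex_transitive_harmonic_centralization.
apply: vertex_transitive_cartesian_product.
  exact: vertex_transitive_path_graph2.
exact: vertex_transitive_cycle_graph.
Qed.
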